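(* Let $\mathbf{H}$ be a bicartesian closed category. Then the semicartesian $\ast$-autonomous category $\mathbf{H}_{\pm}$ (with the structure given in the context) has a Seely comonad $!$. Moreover: \begin{itemize} \item The Seely comonad $!$ is idempotent. \item Its Kleisli category $(\mathbf{H}_{\pm})_!$ is equivalent to $\mathbf H$, and in particular has coproducts. \item The right adjoint $\mathbf{H}_{\pm}\to(\mathbf{H}_{\pm})_!$ is strong monoidal; thus in addition to the Seely conditions we have $!(P\boxtimes Q)\cong\, !P\boxtimes\, !Q$ and $?(P\odot Q)\cong\, ?P\odot\, ?Q$. \end{itemize}
   Context: A bicartesian closed category is a cartesian closed category with finite coproducts. Notation in $\mathbf H$: $\wedge$ for binary products, $\vee$ for binary coproducts, $\mathbf 1$ and $\mathbf 0$ for the terminal and initial objects, $\to$ for exponentials. $\mathbf{H}_{\pm}$ is the full subcategory of $\mathbf{H}\times\mathbf{H}^{\mathrm{op}}$ determined by the pairs $P=(P^+,P^-)$ such that $P^+\wedge P^-$ is initial. A morphism $P\to Q$ is a pair of morphisms $P^+\to Q^+$ and $Q^-\to P^-$ in $\mathbf H$. It has finite products and coproducts, with $P\sqcap Q=(P^+\wedge Q^+,P^-\vee Q^-)$ and $P\sqcup Q=(P^+\vee Q^+,P^-\wedge Q^-)$, and it is a semicartesian $\ast$-autonomous category (semicartesian: the monoidal unit is the terminal object) with unit $\top=(\mathbf 1,\mathbf 0)$, dualizing object $\bot=(\mathbf 0,\mathbf 1)$, $$P\boxtimes Q=\bigl(P^+\wedge Q^+,\ (P^+\to Q^-)\wedge(Q^+\to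 P^-)\bigr),$$ $$P\multimap Q=\bigl((P^+\to Q^+)\wedge(Q^-\to P^-),\ P^+\wedge Q^-\bigr).$$ Write $P^\perp=(P\multimap\bot)\cong(P^-,P^+)$, $P\odot Q=(P^\perp\boxtimes Q^\perp)^\perp$, and $?P=(!(P^\perp))^\perp$. A Seely comonad on a $\ast$-autonomous category $\mathbf L$ with finite products is a comonad $!$ on $\mathbf L$ such that the Kleisli category $\mathbf L_!$ has finite products and the forgetful functor $\mathbf L_!\to\mathbf L$ (the left adjoint of the Kleisli adjunction, acting on objects by $!$) is strong symmetric monoidal, where $\mathbf L_!$ is regarded as cartesian monoidal. (''The Seely conditions'' are the resulting coherent isomorphisms such as $!(P\sqcap Q)\cong\,!P\boxtimes\,!Q$.) The right adjoint in the third bullet is the right adjoint of the Kleisli adjunction, with $\mathbf{H}_{\pm}$ monoidal under $\boxtimes$ and $(\mathbf{H}_{\pm})_!$ cartesian monoidal. A comonad is idempotent if its comultiplication is an isomorphism. *)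

(* Defs.v *)
From Corelib Require Import ssreflect ssrfun.

Set Implicit Arguments.
Unset Strict Implicit.
Unset Printing Implicit Defensive.

Declare Scope cat_scope.
Delimit Scope cat_scope with cat.
Local Open Scope cat_scope.

(** * Categories, functors, equivalences *)

Record Category := {
  Ob :> Type;
  Hom : Ob -> Ob -> Type;
  idm : forall A : Ob, Hom A A;
  compose : forall A B C : Ob, Hom B C -> Hom A B -> Hom A C;
  compose_idl : forall (A B : Ob) (f : Hom A B), compose (idm B) f = f;
  compose_idr : forall (A B : Ob) (f : Hom A B), compose f (idm A) = f;
  compose_assoc : forall (A B C D : Ob)
    (h : Hom C D) (g : Hom B C) (f : Hom A B),
    compose (compose h g) f = compose h (compose g f)
}.

Arguments Hom {_} A B.
Arguments idm {_} A.

Notation "g ∘ f" := (compose g f) (at level 40, left associativity) : cat_scope.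

Definition is_iso (C : Category) (A B : C) (f : Hom A B) : Prop :=
  exists g : Hom B A, g ∘ f = idm A /\ f ∘ g = idm B.

Definition isomorphic (C : Category) (A B : C) : Prop :=
  exists f : Hom A B, is_iso f.

Record Functor (C D : Category) := {
  fobj :> C -> D;
  fmap : forall A B : C, Hom A B -> Hom (fobj A) (fobj B);
  fmap_id : forall A : C, fmap (idm A) = idm (fobj A);
  fmap_comp : forall (A B E : C) (g : Hom B E) (f : Hom A B),
    fmap (g ∘ f) = fmap g ∘ fmap f
}.

Arguments fmap {C D} F {A B} f : rename.

Record NatTrans (C D : Category) (F G : Functor C D) := {
  component :> forall A : C, Hom (F A) (G A);
  naturality : forall (A B : C) (f : Hom A B),
    component B ∘ fmap F f = fmap G f ∘ component A
}.

Definition naturally_isomorphic (C D : Category) (F G : Functor C D) : Prop :=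
  exists t : NatTrans F G, forall A : C, is_iso (t A).

Definition functor_id (C : Category) : Functor C C.
Proof. by refine {| fobj A := A; fmap A B f := f |}. Defined.

Definition functor_comp (C D E : Category) (G : Functor D E) (F : Functor C D) :
  Functor C E.
Proof.
refine {| fobj A := G (F A); fmap A B f := fmap G (fmap F f) |}.
- by move=> A; rewrite !fmap_id.
- by move=> A B X g f; rewrite !fmap_comp.
Defined.

Definition equivalent (C D : Category) : Prop :=
  exists (F : Functor C D) (G : Functor D C),
    naturally_isomorphic (functor_comp G F) (functor_id C) /\
    naturally_isomorphic (functor_comp F G) (functor_id D).

Record Adjunction (C D : Category) (L : Functor C D) (R : Functor D C) := {
  adj_unit : NatTrans (functor_id C) (functor_comp R L);
  adj_counit : NatTrans (functor_comp L R) (functor_id D);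
  adj_triangle_left : forall A : C,
    adj_counit (L A) ∘ fmap L (adj_unit A) = idm (L A);
  adj_triangle_right : forall B : D,
    fmap R (adj_counit B) ∘ adj_unit (R B) = idm (R B)
}.

Definition op_cat (C : Category) : Category.
Proof.
refine {| Ob := C; Hom A B := @Hom C B A; idm A := idm A;
  compose A B E g f := (f ∘ g : @Hom C E A) |}.
- by move=> *; rewrite compose_idr.
- by move=> *; rewrite compose_idl.
- by move=> *; rewrite compose_assoc.
Defined.

Definition prod_cat (C D : Category) : Category.
Proof.
refine {| Ob := (C * D)%type;
  Hom X Y := (Hom X.1 Y.1 * Hom X.2 Y.2)%type;
  idm X := (idm X.1, idm X.2);
  compose X Y Z g f := (g.1 ∘ f.1, g.2 ∘ f.2) |}.
- by move=> X Y [f g] /=; rewrite !compose_idl.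
- by move=> X Y [f g] /=; rewrite !compose_idr.
- by move=> *; rewrite /= !compose_assoc.
Defined.

Definition prod_functor (C D C' D' : Category)
  (F : Functor C C') (G : Functor D D') :
  Functor (prod_cat C D) (prod_cat C' D').
Proof.
refine {| fobj (X : prod_cat C D) := ((F X.1, G X.2) : prod_cat C' D');
  fmap X Y f := (fmap F f.1, fmap G f.2) |}.
- by move=> X; rewrite /= !fmap_id.
- by move=> X Y Z g f; rewrite /= !fmap_comp.
Defined.

(** The full subcategory on a family of objects [i]. *)
Definition full_subcat (C : Category) (T : Type) (i : T -> C) : Category.
Proof.
refine {| Ob := T; Hom X Y := Hom (i X) (i Y); idm X := idm (i X);
  compose X Y Z g f := g ∘ f |}.
- by move=> *; rewrite compose_idl.
- by move=> *; rewrite compose_idr.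
- by move=> *; rewrite compose_assoc.
Defined.

(** * Finite products and coproducts, bicartesian closed categories *)

(** Being terminal or initial is given by the (necessarily unique) maps as data,
    so that they can be used to build other morphisms. *)
Record IsTerminal (C : Category) (A : C) := {
  to_terminal : forall X : C, Hom X A;
  to_terminal_uniq : forall (X : C) (f g : Hom X A), f = g
}.

Record IsInitial (C : Category) (A : C) := {
  from_initial : forall X : C, Hom A X;
  from_initial_uniq : forall (X : C) (f g : Hom A X), f = g
}.

Record FiniteProducts (C : Category) := {
  one : C;
  one_terminal : IsTerminal one;
  product : C -> C -> C;
  proj1 : forall A B : C, Hom (product A B) A;
  proj2 : forall A B : C, Hom (product A B) B;
  pairing : forall X A B : C, Hom X A -> Hom X B -> Hom X (product A B);
  proj1_pairing : forall (X A B : C) (f : Hom X A) (g : Hom X B),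
    proj1 A B ∘ pairing f g = f;
  proj2_pairing : forall (X A B : C) (f : Hom X A) (g : Hom X B),
    proj2 A B ∘ pairing f g = g;
  pairing_uniq : forall (X A B : C) (h : Hom X (product A B)),
    pairing (proj1 A B ∘ h) (proj2 A B ∘ h) = h
}.

Arguments proj1 {C} _ {A B}.
Arguments proj2 {C} _ {A B}.
Arguments pairing {C} _ {X A B} f g.

Definition product_map (C : Category) (P : FiniteProducts C) (A B A' B' : C)
  (f : Hom A A') (g : Hom B B') : Hom (product P A B) (product P A' B') :=
  pairing P (f ∘ proj1 P) (g ∘ proj2 P).

Record FiniteCoproducts (C : Category) := {
  zero : C;
  zero_initial : IsInitial zero;
  coproduct : C -> C -> C;
  inj1 : forall A B : C, Hom A (coproduct A B);
  inj2 : forall A B : C, Hom B (coproduct A B);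
  copairing : forall A B X : C, Hom A X -> Hom B X -> Hom (coproduct A B) X;
  copairing_inj1 : forall (A B X : C) (f : Hom A X) (g : Hom B X),
    copairing f g ∘ inj1 A B = f;
  copairing_inj2 : forall (A B X : C) (f : Hom A X) (g : Hom B X),
    copairing f g ∘ inj2 A B = g;
  copairing_uniq : forall (A B X : C) (h : Hom (coproduct A B) X),
    copairing (h ∘ inj1 A B) (h ∘ inj2 A B) = h
}.

Arguments inj1 {C} _ {A B}.
Arguments inj2 {C} _ {A B}.
Arguments copairing {C} _ {A B X} f g.

Record Exponentials (C : Category) (P : FiniteProducts C) := {
  exponential : C -> C -> C;
  eval : forall A B : C, Hom (product P (exponential A B) A) B;
  curry : forall X A B : C, Hom (product P X A) B -> Hom X (exponential A B);
  eval_curry : forall (X A B : C) (f : Hom (product P X A) B),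
    eval A B ∘ product_map P (curry f) (idm A) = f;
  curry_uniq : forall (X A B : C) (g : Hom X (exponential A B)),
    curry (eval A B ∘ product_map P g (idm A)) = g
}.

Arguments eval {C P} _ {A B}.
Arguments curry {C P} _ {X A B} f.

Record BicartesianClosedCategory := {
  bcc_cat :> Category;
  bcc_prod : FiniteProducts bcc_cat;
  bcc_coprod : FiniteCoproducts bcc_cat;
  bcc_exp : Exponentials bcc_prod
}.

(** * Monoidal structure *)

Record Monoidal (C : Category) := {
  tensor : C -> C -> C;
  tmap : forall A B A' B' : C,
    Hom A A' -> Hom B B' -> Hom (tensor A B) (tensor A' B');
  tmap_id : forall A B : C, tmap (idm A) (idm B) = idm (tensor A B);
  tmap_comp : forall (A B A' B' A'' B'' : C)
    (f' : Hom A' A'') (g' : Hom B' B'') (f : Hom A A') (g : Hom B B'),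
    tmap (f' ∘ f) (g' ∘ g) = tmap f' g' ∘ tmap f g;
  munit : C;
  massoc : forall A B D : C,
    Hom (tensor (tensor A B) D) (tensor A (tensor B D));
  mlunit : forall A : C, Hom (tensor munit A) A;
  mrunit : forall A : C, Hom (tensor A munit) A;
  massoc_iso : forall A B D : C, is_iso (massoc A B D);
  mlunit_iso : forall A : C, is_iso (mlunit A);
  mrunit_iso : forall A : C, is_iso (mrunit A);
  massoc_nat : forall (A B D A' B' D' : C)
    (f : Hom A A') (g : Hom B B') (h : Hom D D'),
    massoc A' B' D' ∘ tmap (tmap f g) h = tmap f (tmap g h) ∘ massoc A B D;
  mlunit_nat : forall (A A' : C) (f : Hom A A'),
    mlunit A' ∘ tmap (idm munit) f = f ∘ mlunit A;
  mrunit_nat : forall (A A' : C) (f : Hom A A'),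
    mrunit A' ∘ tmap f (idm munit) = f ∘ mrunit A;
  pentagon : forall A B D E : C,
    massoc A B (tensor D E) ∘ massoc (tensor A B) D E =
    tmap (idm A) (massoc B D E) ∘ massoc A (tensor B D) E
      ∘ tmap (massoc A B D) (idm E);
  triangle : forall A B : C,
    tmap (idm A) (mlunit B) ∘ massoc A munit B = tmap (mrunit A) (idm B)
}.

Arguments tmap {C} _ {A B A' B'} f g.
Arguments massoc {C} _ A B D.
Arguments mlunit {C} _ A.
Arguments mrunit {C} _ A.

Record Symmetry (C : Category) (M : Monoidal C) := {
  braid : forall A B : C, Hom (tensor M A B) (tensor M B A);
  braid_nat : forall (A B A' B' : C) (f : Hom A A') (g : Hom B B'),
    braid A' B' ∘ tmap M f g = tmap M g f ∘ braid A B;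
  braid_sym : forall A B : C, braid B A ∘ braid A B = idm (tensor M A B);
  hexagon : forall A B D : C,
    massoc M B D A ∘ braid A (tensor M B D) ∘ massoc M A B D =
    tmap M (idm B) (braid A D) ∘ massoc M B A D ∘ tmap M (braid A B) (idm D)
}.

Record Closed (C : Category) (M : Monoidal C) := {
  ihom : C -> C -> C;
  ev : forall A B : C, Hom (tensor M (ihom A B) A) B;
  lam : forall X A B : C, Hom (tensor M X A) B -> Hom X (ihom A B);
  ev_lam : forall (X A B : C) (f : Hom (tensor M X A) B),
    ev A B ∘ tmap M (lam f) (idm A) = f;
  lam_uniq : forall (X A B : C) (g : Hom X (ihom A B)),
    lam (ev A B ∘ tmap M g (idm A)) = g
}.

Arguments ev {C M} _ A B.
Arguments lam {C M} _ {X A B} f.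

(** The canonical map [A -> ((A -o D) -o D)]. *)
Definition to_double_dual (C : Category) (M : Monoidal C) (S : Symmetry M)
  (K : Closed M) (D A : C) : Hom A (ihom K (ihom K A D) D) :=
  lam K (ev K A D ∘ braid S A (ihom K A D)).

Record StarAutonomousCategory := {
  sa_cat :> Category;
  sa_monoidal : Monoidal sa_cat;
  sa_symmetry : Symmetry sa_monoidal;
  sa_closed : Closed sa_monoidal;
  dualizing : sa_cat;
  to_double_dual_iso : forall A : sa_cat,
    is_iso (to_double_dual sa_symmetry sa_closed dualizing A)
}.

Definition semicartesian (L : StarAutonomousCategory) : Prop :=
  inhabited (IsTerminal (munit (sa_monoidal L))).

Record StrongMonoidal (C D : Category) (M : Monoidal C) (N : Monoidal D)
  (F : Functor C D) := {
  mu : forall A B : C, Hom (tensor N (F A) (F B)) (F (tensor M A B));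
  mu_unit : Hom (munit N) (F (munit M));
  mu_nat : forall (A B A' B' : C) (f : Hom A A') (g : Hom B B'),
    mu A' B' ∘ tmap N (fmap F f) (fmap F g) = fmap F (tmap M f g) ∘ mu A B;
  mu_iso : forall A B : C, is_iso (mu A B);
  mu_unit_iso : is_iso mu_unit;
  mu_assoc : forall A B E : C,
    fmap F (massoc M A B E) ∘ mu (tensor M A B) E ∘ tmap N (mu A B) (idm (F E)) =
    mu A (tensor M B E) ∘ tmap N (idm (F A)) (mu B E)
      ∘ massoc N (F A) (F B) (F E);
  mu_lunit : forall A : C,
    fmap F (mlunit M A) ∘ mu (munit M) A ∘ tmap N mu_unit (idm (F A)) =
    mlunit N (F A);
  mu_runit : forall A : C,
    fmap F (mrunit M A) ∘ mu A (munit M) ∘ tmap N (idm (F A)) mu_unit =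
    mrunit N (F A)
}.

Record StrongSymmetricMonoidal (C D : Category) (M : Monoidal C)
  (N : Monoidal D) (SM : Symmetry M) (SN : Symmetry N) (F : Functor C D) := {
  ssm_strong :> StrongMonoidal M N F;
  mu_braid : forall A B : C,
    fmap F (braid SM A B) ∘ mu ssm_strong A B =
    mu ssm_strong B A ∘ braid SN (F A) (F B)
}.

(** If [L -| R] and [L] is strong monoidal, then [R] carries a canonical lax
    monoidal structure, the mate of that of [L]; it is the unique one for which
    the counit [L R -> id] is a monoidal transformation. This says that the
    structure maps of [SR] are these canonical ones. *)
Definition monoidal_counit (C D : Category) (M : Monoidal C) (N : Monoidal D)
  (L : Functor C D) (R : Functor D C) (adj : Adjunction L R)
  (SL : StrongMonoidal M N L) (SR : StrongMonoidal N M R) : Prop :=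
  (forall A B : D,
     adj_counit adj (tensor N A B) ∘ fmap L (mu SR A B) ∘ mu SL (R A) (R B) =
     tmap N (adj_counit adj A) (adj_counit adj B)) /\
  adj_counit adj (munit N) ∘ fmap L (mu_unit SR) ∘ mu_unit SL = idm (munit N).

Lemma pairing_comp (C : Category) (P : FiniteProducts C) (X Y A B : C)
  (f : Hom X A) (g : Hom X B) (h : Hom Y X) :
  pairing P f g ∘ h = pairing P (f ∘ h) (g ∘ h).
Proof.
by rewrite -[LHS]pairing_uniq -!compose_assoc proj1_pairing proj2_pairing.
Qed.

Lemma pairing_ext (C : Category) (P : FiniteProducts C) (X A B : C)
  (h k : Hom X (product P A B)) :
  proj1 P ∘ h = proj1 P ∘ k -> proj2 P ∘ h = proj2 P ∘ k -> h = k.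
Proof. by move=> e1 e2; rewrite -(pairing_uniq h) e1 e2 pairing_uniq. Qed.

Lemma pairing_proj (C : Category) (P : FiniteProducts C) (A B : C) :
  pairing P (@proj1 _ P A B) (@proj2 _ P A B) = idm (product P A B).
Proof. by rewrite -[RHS]pairing_uniq !compose_idr. Qed.

Ltac prod_simp :=
  rewrite ?/product_map /=;
  repeat progress rewrite ?(compose_assoc, compose_idl, compose_idr,
    pairing_comp, proj1_pairing, proj2_pairing, pairing_uniq, pairing_proj).

Ltac prod_solve := repeat apply: pairing_ext; prod_simp; try done;
  try by apply: to_terminal_uniq; exact: one_terminal.

Section CartesianMonoidal.
Context (C : Category) (P : FiniteProducts C).

Definition cartesian_monoidal : Monoidal C.
Proof.
unshelve refine {|
  tensor := product P;
  tmap A B A' B' f g := product_map P f g;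
  munit := one P;
  massoc A B D := pairing P (proj1 P ∘ proj1 P)
                            (pairing P (proj2 P ∘ proj1 P) (proj2 P));
  mlunit A := proj2 P;
  mrunit A := proj1 P |}.
- abstract (move=> *; prod_solve).
- abstract (move=> *; prod_solve).
- abstract (move=> A B D;
  exists (pairing P (pairing P (proj1 P) (proj1 P ∘ proj2 P))
                    (proj2 P ∘ proj2 P)); split; prod_solve).
- abstract (move=> A;
  exists (pairing P (to_terminal (one_terminal P) A) (idm A)); split; prod_solve).
- abstract (move=> A;
  exists (pairing P (idm A) (to_terminal (one_terminal P) A)); split; prod_solve).
- abstract (move=> *; prod_solve).
- abstract (move=> *; prod_solve).
- abstract (move=> *; prod_solve).
- abstract (move=> *; prod_solve).
- abstract (move=> *; prod_solve).
Defined.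

Definition cartesian_symmetry : Symmetry cartesian_monoidal.
Proof.
unshelve refine {|
  braid A B := pairing P (proj2 P) (proj1 P) : Hom (tensor cartesian_monoidal A B) _ |}.
- abstract (move=> *; prod_solve).
- abstract (move=> *; prod_solve).
- abstract (move=> *; prod_solve).
Defined.

Definition product_functor : Functor (prod_cat C C) C.
Proof.
unshelve refine {| fobj (X : prod_cat C C) := product P X.1 X.2;
  fmap X Y f := product_map P f.1 f.2 |}.
- abstract (move=> *; prod_solve).
- abstract (move=> *; prod_solve).
Defined.

End CartesianMonoidal.

Definition tensor_functor (C : Category) (M : Monoidal C) :
  Functor (prod_cat C C) C.
Proof.
refine {| fobj (X : prod_cat C C) := tensor M X.1 X.2;
  fmap X Y f := tmap M f.1 f.2 |}.
- by move=> X; rewrite /= tmap_id.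
- by move=> X Y Z g f; rewrite /= tmap_comp.
Defined.

(** * Comonads and their Kleisli categories *)

Record Comonad (C : Category) := {
  com_functor :> Functor C C;
  counit : forall A : C, Hom (com_functor A) A;
  comult : forall A : C, Hom (com_functor A) (com_functor (com_functor A));
  counit_nat : forall (A B : C) (f : Hom A B),
    counit B ∘ fmap com_functor f = f ∘ counit A;
  comult_nat : forall (A B : C) (f : Hom A B),
    comult B ∘ fmap com_functor f =
    fmap com_functor (fmap com_functor f) ∘ comult A;
  counit_comult : forall A : C,
    counit (com_functor A) ∘ comult A = idm (com_functor A);
  map_counit_comult : forall A : C,
    fmap com_functor (counit A) ∘ comult A = idm (com_functor A);
  comult_comult : forall A : C,
    comult (com_functor A) ∘ comult A =
    fmap com_functor (comult A) ∘ comult A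
}.

Arguments counit {C} _ A.
Arguments comult {C} _ A.

Definition idempotent (C : Category) (T : Comonad C) : Prop :=
  forall A : C, is_iso (comult T A).

Section Kleisli.
Context (C : Category) (T : Comonad C).

Definition Kleisli : Category.
Proof.
refine {| Ob := C; Hom A B := @Hom C (T A) B; idm A := counit T A;
  compose A B D (g : @Hom C (T B) D) (f : @Hom C (T A) B) :=
    g ∘ fmap T f ∘ comult T A |}.
- by move=> A B f; rewrite counit_nat compose_assoc counit_comult compose_idr.
- by move=> A B f; rewrite compose_assoc map_counit_comult compose_idr.
- move=> A B D E h g f; rewrite !fmap_comp !compose_assoc.
  by rewrite -comult_comult -(compose_assoc (comult T B)) comult_nat
     !compose_assoc.
Defined.

Definition kleisli_forget : Functor Kleisli C.
Proof.
refine {| fobj (A : Kleisli) := T A;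
  fmap A B (f : @Hom Kleisli A B) := fmap T (f : @Hom C (T A) B) ∘ comult T A |}.
- by move=> A; rewrite /= map_counit_comult.
- move=> A B D g f; rewrite /= !fmap_comp !compose_assoc.
  by rewrite -comult_comult -(compose_assoc (comult T B)) comult_nat
     !compose_assoc.
Defined.

Definition kleisli_cofree : Functor C Kleisli.
Proof.
refine {| fobj (A : C) := A : Kleisli;
  fmap A B (f : Hom A B) := (f ∘ counit T A : @Hom C (T A) B) |}.
- by move=> A; rewrite /= compose_idl.
- move=> A B D g f; rewrite /= fmap_comp !compose_assoc.
  by rewrite map_counit_comult compose_idr counit_nat.
Defined.

Definition kleisli_unit :
  NatTrans (functor_id Kleisli) (functor_comp kleisli_cofree kleisli_forget).
Proof.
apply: (@Build_NatTrans Kleisli Kleisli (functor_id Kleisli)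
  (functor_comp kleisli_cofree kleisli_forget) (fun A : C => idm (T A))).
move=> A B f /=; rewrite compose_idl !compose_assoc fmap_id compose_idl.
by rewrite counit_comult compose_idr.
Defined.

Definition kleisli_counit :
  NatTrans (functor_comp kleisli_forget kleisli_cofree) (functor_id C).
Proof.
apply: (@Build_NatTrans C C (functor_comp kleisli_forget kleisli_cofree)
  (functor_id C) (fun A : C => counit T A)).
move=> A B f /=; rewrite fmap_comp -compose_assoc -compose_assoc counit_nat.
by rewrite !compose_assoc map_counit_comult compose_idr.
Defined.

Definition kleisli_adjunction : Adjunction kleisli_forget kleisli_cofree.
Proof.
refine {| adj_unit := kleisli_unit; adj_counit := kleisli_counit |}.
- by move=> A /=; rewrite fmap_id compose_idl counit_comult.
- by move=> A /=; rewrite fmap_id compose_idr compose_assoc counit_comult compose_idr.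
Defined.

End Kleisli.

(** [kleisli_forget], the left adjoint, acts on objects by the comonad; it is
    required to be strong symmetric monoidal from [Kleisli] with its cartesian
    structure. *)
Record SeelyComonad (L : StarAutonomousCategory) := {
  seely_comonad :> Comonad L;
  kleisli_products : FiniteProducts (Kleisli seely_comonad);
  seely_strong : StrongSymmetricMonoidal
    (cartesian_symmetry kleisli_products) (sa_symmetry L)
    (kleisli_forget seely_comonad)
}.

(** * Duality, par and why-not in a star-autonomous category *)

Section Duality.
Context (L : StarAutonomousCategory).

Local Notation M := (sa_monoidal L).
Local Notation K := (sa_closed L).

Definition dual (A : L) : L := ihom K A (dualizing L).

Definition dual_map (A B : L) (f : Hom A B) : Hom (dual B) (dual A) :=
  lam K (ev K B (dualizing L) ∘ tmap M (idm (dual B)) f).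

Lemma dual_map_id (A : L) : dual_map (idm A) = idm (dual A).
Proof. exact: lam_uniq. Qed.

Lemma dual_map_comp (A B D : L) (g : Hom B D) (f : Hom A B) :
  dual_map (g ∘ f) = dual_map f ∘ dual_map g.
Proof.
have e (h : Hom A B) : ev K A (dualizing L) ∘ tmap M (dual_map h) (idm A) =
    ev K B (dualizing L) ∘ tmap M (idm (dual B)) h by exact: ev_lam.
have e' (h : Hom B D) : ev K B (dualizing L) ∘ tmap M (dual_map h) (idm B) =
    ev K D (dualizing L) ∘ tmap M (idm (dual D)) h by exact: ev_lam.
rewrite -[RHS]lam_uniq; congr (lam K _).
have -> : tmap M (dual_map f ∘ dual_map g) (idm A) =
          tmap M (dual_map f) (idm A) ∘ tmap M (dual_map g) (idm A).
  by rewrite -tmap_comp compose_idl.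
rewrite -compose_assoc e compose_assoc -tmap_comp compose_idl compose_idr.
have -> : tmap M (dual_map g) f =
          tmap M (dual_map g) (idm B) ∘ tmap M (idm (dual D)) f.
  by rewrite -tmap_comp compose_idl compose_idr.
by rewrite -compose_assoc e' compose_assoc -tmap_comp compose_idl.
Qed.

Definition par_functor : Functor (prod_cat L L) L.
Proof.
refine {| fobj (X : prod_cat L L) := dual (tensor M (dual X.1) (dual X.2));
  fmap X Y f := dual_map (tmap M (dual_map f.1) (dual_map f.2)) |}.
- by move=> X; rewrite /= !dual_map_id tmap_id dual_map_id.
- by move=> X Y Z g f; rewrite /= !dual_map_comp tmap_comp dual_map_comp.
Defined.

Definition whynot_functor (T : Comonad L) : Functor L L.
Proof.
refine {| fobj A := dual (T (dual A));
  fmap A B f := dual_map (fmap T (dual_map f)) |}.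
- by move=> A; rewrite !dual_map_id fmap_id dual_map_id.
- by move=> A B D g f; rewrite dual_map_comp fmap_comp dual_map_comp.
Defined.

End Duality.

(** * The category of pairs *)

Section Exponents.
Context (C : Category) (P : FiniteProducts C) (E : Exponentials P).

Lemma curry_ext (X A B : C) (h k : Hom X (exponential E A B)) :
  eval E ∘ pairing P (h ∘ proj1 P) (proj2 P) =
  eval E ∘ pairing P (k ∘ proj1 P) (proj2 P) -> h = k.
Proof.
move=> e; rewrite -(curry_uniq h) -(curry_uniq k) /product_map compose_idl.
by rewrite e.
Qed.

Lemma eval_pairing_curry (X A B : C) (f : Hom (product P X A) B) (g : Hom X A) :
  eval E ∘ pairing P (curry E f) g = f ∘ pairing P (idm X) g.
Proof.
rewrite -[in RHS](eval_curry E f) /product_map compose_assoc.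
by rewrite pairing_comp !compose_assoc proj1_pairing proj2_pairing compose_idr compose_idl.
Qed.

Lemma eval_curry_comp (X Y A B : C) (f : Hom (product P X A) B)
  (h : Hom Y X) (g : Hom Y A) :
  eval E ∘ pairing P (curry E f ∘ h) g = f ∘ pairing P h g.
Proof.
rewrite -[in RHS](eval_curry E f) /product_map compose_assoc.
by rewrite pairing_comp !compose_assoc proj1_pairing proj2_pairing compose_idl.
Qed.

End Exponents.

Section Pairs.
Context (H : BicartesianClosedCategory).

Local Notation "A × B" := (product (bcc_prod H) A B)
  (at level 40, left associativity).
Local Notation "A + B" := (coproduct (bcc_coprod H) A B).
Local Notation "A ⇒ B" := (exponential (bcc_exp H) A B)
  (at level 55, right associativity).
Local Notation "⟨ f , g ⟩" := (pairing (bcc_prod H) f g).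
Local Notation π1 := (proj1 (bcc_prod H)).
Local Notation π2 := (proj2 (bcc_prod H)).
Local Notation λ := (curry (bcc_exp H)).
Local Notation O := (zero (bcc_coprod H)).
Local Notation I := (one (bcc_prod H)).
Local Notation app f x := (eval (bcc_exp H) ∘ ⟨ f , x ⟩).
Local Notation ter := (to_terminal (one_terminal (bcc_prod H)) _).

(** In a cartesian closed category every object with a map to [O] is initial. *)
Lemma strict_zero (X : H) : Hom X O -> IsInitial X.
Proof.
move=> z; split=> [Y|Y f g].
  exact: (from_initial (zero_initial (bcc_coprod H)) Y ∘ z).
have e (h : Hom X Y) : h = app (λ (h ∘ π2) ∘ z) (idm X).
  by rewrite eval_curry_comp compose_assoc proj2_pairing compose_idr.
rewrite (e f) (e g); congr (app (_ ∘ z) _).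
apply: from_initial_uniq; exact: zero_initial.
Defined.

Lemma zero_uniq (X : H) (f g : Hom X O) : f = g.
Proof. exact: (from_initial_uniq (strict_zero f)). Qed.

(** Morphisms [P -> Q] are pairs [pos P -> pos Q], [neg Q -> neg P], the second
    component being a morphism of [op_cat H]. *)
Record pm_ob := {
  pos : H;
  neg : H;
  pos_neg_initial : IsInitial (pos × neg)
}.

Definition Hpm : Category :=
  full_subcat (C := prod_cat H (op_cat H)) (fun P : pm_ob => (pos P, neg P)).

Definition pm_hom (P Q : Hpm) (f : Hom (pos P) (pos Q)) (g : Hom (neg Q) (neg P)) :
  Hom P Q := (f, g).

Definition pos_map (P Q : Hpm) (f : Hom P Q) : Hom (pos P) (pos Q) := f.1.

Definition neg_map (P Q : Hpm) (f : Hom P Q) : Hom (neg Q) (neg P) := f.2.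

Definition contra (P : pm_ob) : Hom (pos P × neg P) O :=
  from_initial (pos_neg_initial P) O.

Definition pm_top : Hpm := Build_pm_ob (@strict_zero (I × O) π2).

Definition pm_bot : Hpm := Build_pm_ob (@strict_zero (O × I) π1).

Definition pm_meet (P Q : Hpm) : Hpm :=
  Build_pm_ob (@strict_zero ((pos P × pos Q) × (neg P + neg Q))
    (app (copairing (bcc_coprod H)
            (λ (contra P ∘ ⟨π1 ∘ π2, π1⟩))
            (λ (contra Q ∘ ⟨π2 ∘ π2, π1⟩)) ∘ π2) π1)).

Definition pm_join (P Q : Hpm) : Hpm :=
  Build_pm_ob (@strict_zero ((pos P + pos Q) × (neg P × neg Q))
    (app (copairing (bcc_coprod H)
            (λ (contra P ∘ ⟨π1, π1 ∘ π2⟩))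
            (λ (contra Q ∘ ⟨π1, π2 ∘ π2⟩)) ∘ π1) π2)).

Definition pm_tensor (P Q : Hpm) : Hpm :=
  Build_pm_ob (@strict_zero
    ((pos P × pos Q) × ((pos P ⇒ neg Q) × (pos Q ⇒ neg P)))
    (contra Q ∘ ⟨π2 ∘ π1, app (π1 ∘ π2) (π1 ∘ π1)⟩)).

Definition pm_ihom (P Q : Hpm) : Hpm :=
  Build_pm_ob (@strict_zero
    (((pos P ⇒ pos Q) × (neg Q ⇒ neg P)) × (pos P × neg Q))
    (contra Q ∘ ⟨app (π1 ∘ π1) (π1 ∘ π2), π2 ∘ π2⟩)).

Lemma pm_ext (P Q : Hpm) (f g : Hom P Q) : pos_map f = pos_map g -> neg_map f = neg_map g -> f = g.
Proof. by case: f g => [f1 f2] [g1 g2] /= -> ->. Qed.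

Lemma eq_from_nf (X A : H) (f f' g g' : Hom X A) :
  f = f' -> g = g' -> f' = g' -> f = g.
Proof. by move=> -> ->. Qed.

Lemma nf_comp (X A B : H) (f : Hom A B) (g g' : Hom X A) (v : Hom X B) :
  g = g' -> f ∘ g' = v -> f ∘ g = v.
Proof. by move=> ->. Qed.

Lemma nf_pair (X A B : H) (f f' : Hom X A) (g g' : Hom X B) (v : Hom X (A × B)) :
  f = f' -> g = g' -> ⟨f', g'⟩ = v -> ⟨f, g⟩ = v.
Proof. by move=> -> ->. Qed.

Lemma ap_comp (X A B D : H) (f : Hom B D) (g : Hom A B) (x : Hom X A) u v :
  g ∘ x = u -> f ∘ u = v -> (f ∘ g) ∘ x = v.
Proof. by rewrite compose_assoc => -> ->. Qed.

Lemma ap_pair (X A B D : H) (f : Hom A B) (g : Hom A D) (x : Hom X A) f' g' v :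
  f ∘ x = f' -> g ∘ x = g' -> ⟨f', g'⟩ = v -> ⟨f, g⟩ ∘ x = v.
Proof. by rewrite pairing_comp => -> ->. Qed.

Lemma ap_closure (X Y A B : H) (f : Hom (Y × A) B) (e : Hom X Y) (x : Hom X A) v :
  f ∘ ⟨e, x⟩ = v -> app (λ f ∘ e) x = v.
Proof. by rewrite eval_curry_comp. Qed.

Lemma ap_curry (X A B : H) (f : Hom (X × A) B) (x : Hom X A) v :
  f ∘ ⟨idm X, x⟩ = v -> app (λ f) x = v.
Proof. by rewrite eval_pairing_curry. Qed.

(* Evaluation of categorical combinators by an environment machine. *)
Ltac nf_eta :=
  lazymatch goal with
  | |- pairing _ (proj1 _ ∘ ?x) (proj2 _ ∘ ?x) = _ => exact: pairing_uniq
  | |- pairing _ (proj1 _) (proj2 _) = _ => exact: pairing_proj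
  | |- _ => exact: erefl
  end.

Ltac ap :=
  lazymatch goal with
  | |- idm _ ∘ _ = _ => exact: compose_idl
  | |- (_ ∘ _) ∘ _ = _ => eapply ap_comp; [ap | ap]
  | |- pairing _ _ _ ∘ _ = _ => eapply ap_pair; [ap | ap | nf_eta]
  | |- proj1 _ ∘ pairing _ _ _ = _ => exact: proj1_pairing
  | |- proj2 _ ∘ pairing _ _ _ = _ => exact: proj2_pairing
  | |- eval _ ∘ pairing _ (curry _ _ ∘ _) _ = _ => eapply ap_closure; ap
  | |- eval _ ∘ pairing _ (curry _ _) _ = _ => eapply ap_curry; ap
  | |- _ ∘ idm _ = _ => exact: compose_idr
  | |- _ ∘ pairing _ (proj1 _ ∘ ?x) (proj2 _ ∘ ?x) = _ =>
      rewrite (pairing_uniq x); exact: erefl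
  | |- _ ∘ pairing _ (proj1 _) (proj2 _) = _ =>
      rewrite pairing_proj; exact: compose_idr
  | |- _ => exact: erefl
  end.

Ltac nf :=
  lazymatch goal with
  | |- _ ∘ _ = _ => eapply nf_comp; [nf | ap]
  | |- pairing _ _ _ = _ => eapply nf_pair; [nf | nf | nf_eta]
  | |- _ => exact: erefl
  end.

Ltac ccc_ext :=
  lazymatch goal with
  | |- @eq (@Hom _ _ (product _ _ _)) _ _ => apply: pairing_ext; ccc_ext
  | |- @eq (@Hom _ _ (exponential _ _ _)) _ _ => apply: curry_ext; ccc_ext
  | |- @eq (@Hom _ _ (one _)) _ _ => exact: to_terminal_uniq (one_terminal _) _ _ _
  | |- @eq (@Hom _ _ (zero _)) _ _ => exact: zero_uniq
  | |- _ => eapply eq_from_nf; [nf | nf | ]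
  end.

Ltac pm_solve := apply: pm_ext; rewrite /= ?/product_map ?/pos_map ?/neg_map /=; ccc_ext;
  try exact: erefl;
  try (repeat (congr (compose _ _); try exact: erefl); congr (⟨_, _⟩);
       apply: to_terminal_uniq; exact: one_terminal).

Definition pm_products : FiniteProducts Hpm.
Proof.
unshelve refine {|
  one := pm_top;
  one_terminal := {| to_terminal (P : Hpm) :=
    @pm_hom P pm_top ter (from_initial (zero_initial (bcc_coprod H)) _) |};
  product := pm_meet;
  proj1 P Q := @pm_hom (pm_meet P Q) P π1 (inj1 (bcc_coprod H));
  proj2 P Q := @pm_hom (pm_meet P Q) Q π2 (inj2 (bcc_coprod H));
  pairing X P Q f g :=
    @pm_hom X (pm_meet P Q) ⟨pos_map f, pos_map g⟩ (copairing (bcc_coprod H) (neg_map f) (neg_map g)) |}.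
- abstract (move=> P f g; apply: pm_ext;
  [exact: to_terminal_uniq (one_terminal _) _ _ _
  |exact: from_initial_uniq (zero_initial _) _ _ _]).
- abstract (move=> X P Q f g; apply: pm_ext; rewrite /pos_map /neg_map /=;
  [exact: proj1_pairing | exact: copairing_inj1]).
- abstract (move=> X P Q f g; apply: pm_ext; rewrite /pos_map /neg_map /=;
  [exact: proj2_pairing | exact: copairing_inj2]).
- abstract (move=> X P Q h; apply: pm_ext; rewrite /pos_map /neg_map /=;
  [exact: pairing_uniq | exact: copairing_uniq]).
Defined.

Definition pm_coproducts : FiniteCoproducts Hpm.
Proof.
unshelve refine {|
  zero := pm_bot;
  zero_initial := {| from_initial (P : Hpm) :=
    @pm_hom pm_bot P (from_initial (zero_initial (bcc_coprod H)) _) ter |};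
  coproduct := pm_join;
  inj1 P Q := @pm_hom P (pm_join P Q) (inj1 (bcc_coprod H)) π1;
  inj2 P Q := @pm_hom Q (pm_join P Q) (inj2 (bcc_coprod H)) π2;
  copairing P Q X f g :=
    @pm_hom (pm_join P Q) X (copairing (bcc_coprod H) (pos_map f) (pos_map g)) ⟨neg_map f, neg_map g⟩ |}.
- abstract (move=> P f g; apply: pm_ext;
  [exact: from_initial_uniq (zero_initial _) _ _ _
  |exact: to_terminal_uniq (one_terminal _) _ _ _]).
- abstract (move=> X P Q f g; apply: pm_ext; rewrite /pos_map /neg_map /=;
  [exact: copairing_inj1 | exact: proj1_pairing]).
- abstract (move=> X P Q f g; apply: pm_ext; rewrite /pos_map /neg_map /=;
  [exact: copairing_inj2 | exact: proj2_pairing]).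
- abstract (move=> X P Q h; apply: pm_ext; rewrite /pos_map /neg_map /=;
  [exact: copairing_uniq | exact: pairing_uniq]).
Defined.

Definition pm_tmap (P Q P' Q' : Hpm) (f : Hom P P') (g : Hom Q Q') :
  Hom (pm_tensor P Q) (pm_tensor P' Q') :=
  pm_hom (P := pm_tensor P Q) (Q := pm_tensor P' Q')
    (product_map (bcc_prod H) (pos_map f) (pos_map g))
    ⟨λ (neg_map g ∘ app (π1 ∘ π1) (pos_map f ∘ π2)),
     λ (neg_map f ∘ app (π2 ∘ π1) (pos_map g ∘ π2))⟩.

Definition pm_assoc (P Q R : Hpm) :
  Hom (pm_tensor (pm_tensor P Q) R) (pm_tensor P (pm_tensor Q R)) :=
  pm_hom (P := pm_tensor (pm_tensor P Q) R) (Q := pm_tensor P (pm_tensor Q R))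
    ⟨π1 ∘ π1, ⟨π2 ∘ π1, π2⟩⟩
    ⟨λ (app (π1 ∘ app (π1 ∘ π1) (π1 ∘ π2)) (π2 ∘ π2)),
     λ ⟨λ (app (π2 ∘ app (π1 ∘ π1 ∘ π1) π2) (π2 ∘ π1)),
        λ (app (π2 ∘ π1 ∘ π1) ⟨π2, π2 ∘ π1⟩)⟩⟩.

Definition pm_assoc_inv (P Q R : Hpm) :
  Hom (pm_tensor P (pm_tensor Q R)) (pm_tensor (pm_tensor P Q) R) :=
  pm_hom (P := pm_tensor P (pm_tensor Q R)) (Q := pm_tensor (pm_tensor P Q) R)
    ⟨⟨π1, π1 ∘ π2⟩, π2 ∘ π2⟩
    ⟨λ ⟨λ (app (π1 ∘ π1 ∘ π1) ⟨π2 ∘ π1, π2⟩),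
        λ (app (π1 ∘ app (π2 ∘ π1 ∘ π1) π2) (π2 ∘ π1))⟩,
     λ (app (π2 ∘ app (π2 ∘ π1) (π2 ∘ π2)) (π1 ∘ π2))⟩.

Definition pm_lunit (P : Hpm) : Hom (pm_tensor pm_top P) P :=
  pm_hom (P := pm_tensor pm_top P) (Q := P) π2
    ⟨λ π1, λ (contra P ∘ ⟨π2, π1⟩)⟩.

Definition pm_runit (P : Hpm) : Hom (pm_tensor P pm_top) P :=
  pm_hom (P := pm_tensor P pm_top) (Q := P) π1
    ⟨λ (contra P ∘ ⟨π2, π1⟩), λ π1⟩.

Definition pm_monoidal : Monoidal Hpm.
Proof.
unshelve refine {| tensor := pm_tensor; tmap := pm_tmap; munit := pm_top;
  massoc := pm_assoc; mlunit := pm_lunit; mrunit := pm_runit |}.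
- abstract (move=> *; pm_solve).
- abstract (move=> *; pm_solve).
- abstract (move=> P Q R; exists (pm_assoc_inv P Q R); split; pm_solve).
- abstract (move=> P; exists (pm_hom (P := P) (Q := pm_tensor pm_top P)
    ⟨ter, idm _⟩ (app π1 ter)); split; pm_solve).
- abstract (move=> P; exists (pm_hom (P := P) (Q := pm_tensor P pm_top)
    ⟨idm _, ter⟩ (app π2 ter)); split; pm_solve).
- abstract (move=> *; pm_solve).
- abstract (move=> *; pm_solve).
- abstract (move=> *; pm_solve).
- abstract (move=> *; pm_solve).
- abstract (move=> *; pm_solve).
Defined.

Definition pm_symmetry : Symmetry pm_monoidal.
Proof.
unshelve refine {| braid P Q :=
  pm_hom (P := pm_tensor P Q) (Q := pm_tensor Q P) ⟨π2, π1⟩ ⟨π2, π1⟩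
  : Hom (tensor pm_monoidal P Q) (tensor pm_monoidal Q P) |}.
- abstract (move=> *; pm_solve).
- abstract (move=> *; pm_solve).
- abstract (move=> *; pm_solve).
Defined.

Definition pm_closed : Closed pm_monoidal.
Proof.
unshelve refine {| ihom := pm_ihom : Hpm -> Hpm -> Hpm;
  ev P Q := pm_hom (P := pm_tensor (pm_ihom P Q) P) (Q := Q)
    (app (π1 ∘ π1) π2)
    ⟨λ (app (π2 ∘ π2) π1), λ ⟨π2, π1⟩⟩
    : Hom (tensor pm_monoidal (pm_ihom P Q) P) Q;
  lam X P Q (f : Hom (pm_tensor X P) Q) :=
    pm_hom (P := X) (Q := pm_ihom P Q)
      ⟨λ (pos_map f), λ (app (π1 ∘ neg_map f ∘ π2) π1)⟩
      (app (π2 ∘ neg_map f ∘ π2) π1) |}.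
- abstract (move=> *; pm_solve).
- abstract (move=> *; pm_solve).
Defined.

Definition Hpm_star : StarAutonomousCategory.
Proof.
unshelve refine {| sa_cat := Hpm; sa_symmetry := pm_symmetry;
  sa_closed := pm_closed; dualizing := pm_bot |}.
abstract (move=> P; exists
  (pm_hom (P := pm_ihom (pm_ihom P pm_bot) pm_bot) (Q := P)
    (π1 ∘ app π2 ter) ⟨⟨λ (contra P ∘ ⟨π2, π1⟩), λ π1⟩, ter⟩); split; pm_solve).
Defined.

Lemma Hpm_semicartesian : semicartesian Hpm_star.
Proof. by split; exact: one_terminal pm_products. Qed.

End Pairs.

(* Main.v *)
From Corelib Require Import ssreflect ssrfun.
Require Import Defs.
Local Open Scope cat_scope.

Set Implicit Arguments.
Unset Strict Implicit.
Unset Printing Implicit Defensive.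

(** The comonad is [!P = (P⁺, P⁺ → 0)].  In a bicartesian closed category any two
    maps into [0] are equal, so any two maps [X → (A → 0)] are equal too.  Hence
    a morphism [!P → Q] of pairs carries no information in its negative
    component: every [f : P⁺ → Q⁺] has exactly one such extension, because
    [P⁺ ∧ Q⁻ → Q⁺ ∧ Q⁻ → 0] supplies the map [Q⁻ → (P⁺ → 0)].  This is the
    defining property of the objects called [Affirmative] below, those whose
    negative part is the pseudocomplement of their positive part, and it is
    expressed by [lift] and [affirmative_ext].  Besides the objects [!P], the unit
    [⊤] is affirmative and affirmative objects are closed under [⊠].

    Everything follows from this observation.  A Kleisli morphism [P → Q] is the
    same thing as a map [P⁺ → Q⁺]: the functor [kleisli_pos] from the Kleisli
    category to [H] is fully faithful, and it is surjective on objects since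
    [(A, A → 0)] has positive part [A]; thus it is an equivalence
    ([kleisli_equivalent]).  Fully faithful functors reflect products and
    coproducts, and the positive parts of [P ⊓ Q] and [P ⊔ Q] are [P⁺ ∧ Q⁺] and
    [P⁺ ∨ Q⁺].  The objects [!(P ⊓ Q)], [!(P ⊠ Q)] and [!P ⊠ !Q] are all
    affirmative with positive part [P⁺ ∧ Q⁺], so the structure maps comparing them
    are the lifts of the identity; they are isomorphisms, and every coherence law
    is an equation between morphisms out of an affirmative object, to be checked
    on positive parts, where it concerns the cartesian structure of [H] alone.

    The isomorphism for [?] is the dual of the one for [!] and uses of [H±] only
    that its double dualization is a natural isomorphism ([whynot_par]). *)

(** * Isomorphisms and fully faithful functors *)

Lemma id_is_iso (C : Category) (A : C) : is_iso (idm A).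
Proof. by exists (idm A); rewrite compose_idl. Qed.

Lemma comp_is_iso (C : Category) (A B E : C) (g : Hom B E) (f : Hom A B) :
  is_iso g -> is_iso f -> is_iso (g ∘ f).
Proof.
move=> [g' [gg1 gg2]] [f' [ff1 ff2]]; exists (f' ∘ g'); split.
  by rewrite compose_assoc -(compose_assoc g') gg1 compose_idl.
by rewrite compose_assoc -(compose_assoc f) ff2 compose_idl.
Qed.

Lemma fmap_is_iso (C E : Category) (F : Functor C E) (A B : C) (f : Hom A B) :
  is_iso f -> is_iso (fmap F f).
Proof.
move=> [g [gf fg]]; exists (fmap F g).
by rewrite -!fmap_comp gf fg !fmap_id.
Qed.

Lemma tmap_is_iso (C : Category) (N : Monoidal C) (A B A' B' : C)
  (f : Hom A A') (g : Hom B B') : is_iso f -> is_iso g -> is_iso (tmap N f g).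
Proof.
move=> [f' [ff1 ff2]] [g' [gg1 gg2]]; exists (tmap N f' g').
by rewrite -!tmap_comp ff1 ff2 gg1 gg2 !tmap_id.
Qed.

Lemma product_map_id (C : Category) (P : FiniteProducts C) (A B : C) :
  product_map P (idm A) (idm B) = idm (product P A B).
Proof. by rewrite /product_map !compose_idl pairing_proj. Qed.

Record FullyFaithful (C D : Category) (F : Functor C D) := {
  preimage : forall A B : C, Hom (F A) (F B) -> Hom A B;
  fmap_preimage : forall (A B : C) (f : Hom (F A) (F B)),
    fmap F (preimage f) = f;
  faithful : forall (A B : C) (f g : Hom A B), fmap F f = fmap F g -> f = g
}.

Arguments preimage {C D F} _ {A B} f.

(** Universal cones and cocones on a single object, so that one can say of [F R],
    for a functor [F], that it is a product of [F A] and [F B]. *)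
Record IsProduct (C : Category) (A B R : C) := {
  leg1 : Hom R A;
  leg2 : Hom R B;
  tuple : forall X : C, Hom X A -> Hom X B -> Hom X R;
  leg1_tuple : forall (X : C) (f : Hom X A) (g : Hom X B), leg1 ∘ tuple f g = f;
  leg2_tuple : forall (X : C) (f : Hom X A) (g : Hom X B), leg2 ∘ tuple f g = g;
  tuple_uniq : forall (X : C) (h : Hom X R), tuple (leg1 ∘ h) (leg2 ∘ h) = h
}.

Record IsCoproduct (C : Category) (A B R : C) := {
  coleg1 : Hom A R;
  coleg2 : Hom B R;
  cotuple : forall X : C, Hom A X -> Hom B X -> Hom R X;
  cotuple_coleg1 : forall (X : C) (f : Hom A X) (g : Hom B X),
    cotuple f g ∘ coleg1 = f;
  cotuple_coleg2 : forall (X : C) (f : Hom A X) (g : Hom B X),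
    cotuple f g ∘ coleg2 = g;
  cotuple_uniq : forall (X : C) (h : Hom R X),
    cotuple (h ∘ coleg1) (h ∘ coleg2) = h
}.

Definition product_is_product (C : Category) (P : FiniteProducts C) (A B : C) :
  IsProduct A B (product P A B) :=
  Build_IsProduct (fun X => @proj1_pairing _ P X A B)
    (fun X => @proj2_pairing _ P X A B) (fun X => @pairing_uniq _ P X A B).

Definition coproduct_is_coproduct (C : Category) (P : FiniteCoproducts C)
  (A B : C) : IsCoproduct A B (coproduct P A B) :=
  Build_IsCoproduct (fun X => @copairing_inj1 _ P A B X)
    (fun X => @copairing_inj2 _ P A B X) (fun X => @copairing_uniq _ P A B X).

Section FullyFaithful.
Context (C D : Category) (F : Functor C D) (ff : FullyFaithful F).

Lemma preimage_is_iso (A B : C) (f : Hom (F A) (F B)) :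
  is_iso f -> is_iso (preimage ff f).
Proof.
move=> [g [gf fg]]; exists (preimage ff g).
by split; apply: (faithful ff); rewrite fmap_comp fmap_id !fmap_preimage.
Qed.

Definition reflect_products (o : C) (to : IsTerminal (F o)) (p : C -> C -> C)
  (tp : forall A B : C, IsProduct (F A) (F B) (F (p A B))) : FiniteProducts C.
Proof.
unshelve refine {| one := o;
  one_terminal := {| to_terminal X := preimage ff (to_terminal to (F X)) |};
  product := p;
  proj1 A B := preimage ff (leg1 (tp A B));
  proj2 A B := preimage ff (leg2 (tp A B));
  pairing X A B f g := preimage ff (tuple (tp A B) (fmap F f) (fmap F g)) |}.
- by move=> X f g; apply: (faithful ff); exact: to_terminal_uniq to _ _ _.
- move=> X A B f g; apply: (faithful ff); rewrite fmap_comp !fmap_preimage.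
  exact: leg1_tuple.
- move=> X A B f g; apply: (faithful ff); rewrite fmap_comp !fmap_preimage.
  exact: leg2_tuple.
- move=> X A B h; apply: (faithful ff); rewrite !fmap_comp !fmap_preimage.
  exact: tuple_uniq.
Defined.

Definition reflect_coproducts (o : C) (io : IsInitial (F o)) (p : C -> C -> C)
  (ip : forall A B : C, IsCoproduct (F A) (F B) (F (p A B))) :
  FiniteCoproducts C.
Proof.
unshelve refine {| zero := o;
  zero_initial := {| from_initial X := preimage ff (from_initial io (F X)) |};
  coproduct := p;
  inj1 A B := preimage ff (coleg1 (ip A B));
  inj2 A B := preimage ff (coleg2 (ip A B));
  copairing A B X f g :=
    preimage ff (cotuple (ip A B) (fmap F f) (fmap F g)) |}.
- by move=> X f g; apply: (faithful ff); exact: from_initial_uniq io _ _ _.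
- move=> A B X f g; apply: (faithful ff); rewrite fmap_comp !fmap_preimage.
  exact: cotuple_coleg1.
- move=> A B X f g; apply: (faithful ff); rewrite fmap_comp !fmap_preimage.
  exact: cotuple_coleg2.
- move=> A B X h; apply: (faithful ff); rewrite !fmap_comp !fmap_preimage.
  exact: cotuple_uniq.
Defined.

(** Essential surjectivity is given by chosen preimages [G A] and chosen
    isomorphisms [s A], which turn [G] into a quasi-inverse functor by
    conjugation. *)
Lemma fully_faithful_equivalent (G : D -> C)
  (s : forall A : D, Hom (F (G A)) A) (r : forall A : D, Hom A (F (G A))) :
  (forall A : D, r A ∘ s A = idm (F (G A))) ->
  (forall A : D, s A ∘ r A = idm A) -> equivalent C D.
Proof.
move=> rs sr.
have iso_s A : is_iso (s A) by exists (r A).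
pose map (A B : D) (f : Hom A B) := preimage ff (r B ∘ f ∘ s A).
have map_id A : map A A (idm A) = idm (G A).
  by apply: (faithful ff); rewrite fmap_preimage compose_idr rs fmap_id.
have map_comp A B E (g : Hom B E) (f : Hom A B) :
    map A E (g ∘ f) = map B E g ∘ map A B f.
  apply: (faithful ff); rewrite fmap_comp !fmap_preimage.
  by rewrite !compose_assoc -(compose_assoc (s B)) sr compose_idl.
pose GF := Build_Functor map_id map_comp.
exists F, GF; split.
  unshelve refine (ex_intro _ (@Build_NatTrans _ _ (functor_comp GF F)
    (functor_id C) (fun A => preimage ff (s (F A))) _) _).
    move=> A B f; apply: (faithful ff); rewrite !fmap_comp !fmap_preimage.
    by rewrite -!compose_assoc sr compose_idl.
  by move=> A; apply: preimage_is_iso; exact: iso_s (F A).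
unshelve refine (ex_intro _ (@Build_NatTrans _ _ (functor_comp F GF)
  (functor_id D) s _) _) => //.
move=> A B f /=; rewrite fmap_preimage.
by rewrite -!compose_assoc sr compose_idl.
Qed.
End FullyFaithful.

(** * Kleisli arrows as arrows of the base category *)

Section KleisliArrows.
Context (C : Category) (T : Comonad C).

(** The Kleisli category has the objects of [C], and its arrows [A → B] are the
    arrows [T A → B]; the next four functions are identities that record in
    which of the two categories an object or an arrow is considered. *)
Definition to_kleisli_ob (A : C) : Kleisli T := A.

Definition of_kleisli_ob (A : Kleisli T) : C := A.

Definition of_kleisli (A B : Kleisli T) (f : Hom A B) :
  Hom (T (of_kleisli_ob A)) (of_kleisli_ob B) := f.

Definition to_kleisli (A B : Kleisli T)
  (f : Hom (T (of_kleisli_ob A)) (of_kleisli_ob B)) : Hom A B := f.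

Lemma of_kleisli_inj (A B : Kleisli T) (f g : Hom A B) :
  of_kleisli f = of_kleisli g -> f = g.
Proof. by []. Qed.

Lemma to_kleisliK (A B : Kleisli T)
  (f : Hom (T (of_kleisli_ob A)) (of_kleisli_ob B)) :
  of_kleisli (to_kleisli f) = f.
Proof. by []. Qed.

Lemma of_kleisli_comp (A B D : Kleisli T) (g : Hom B D) (f : Hom A B) :
  of_kleisli (g ∘ f) =
  of_kleisli g ∘ fmap T (of_kleisli f) ∘ comult T (of_kleisli_ob A).
Proof. by []. Qed.

Lemma kleisli_forget_map (A B : Kleisli T) (f : Hom A B) :
  fmap (kleisli_forget T) f =
  fmap T (of_kleisli f) ∘ comult T (of_kleisli_ob A).
Proof. by []. Qed.

Lemma of_kleisli_cofree (A B : C) (f : Hom A B) :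
  of_kleisli (fmap (kleisli_cofree T) f) = f ∘ counit T A.
Proof. by []. Qed.

Definition forget_counit (A : C) :
  Hom (kleisli_forget T (kleisli_cofree T A)) A := counit T A.

(** The adjunction transposes a Kleisli arrow [A → B] to itself, seen as an arrow
    [T A → B]. *)
Lemma counit_forget (A : Kleisli T) (B : C) (f : Hom A (kleisli_cofree T B)) :
  forget_counit B ∘ fmap (kleisli_forget T) f = of_kleisli f.
Proof.
rewrite /= -compose_assoc counit_nat compose_assoc counit_comult.
exact: compose_idr.
Qed.

Lemma kleisli_monoidal_counit (M : Monoidal C) (N : Monoidal (Kleisli T))
  (SL : StrongMonoidal N M (kleisli_forget T))
  (SR : StrongMonoidal M N (kleisli_cofree T)) :
  (forall A B : C,
     of_kleisli (mu SR A B) ∘ mu SL (kleisli_cofree T A) (kleisli_cofree T B) =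
     tmap M (forget_counit A) (forget_counit B)) ->
  of_kleisli (mu_unit SR) ∘ mu_unit SL = idm (munit M) ->
  monoidal_counit (kleisli_adjunction T) SL SR.
Proof.
move=> e e1; split=> [A B|]; [rewrite -[RHS]e|rewrite -[RHS]e1];
  congr (_ ∘ _); exact: counit_forget.
Qed.

End KleisliArrows.

(** * Why-not and par *)

Section WhyNot.
Context (L : StarAutonomousCategory).

Local Notation M := (sa_monoidal L).
Local Notation S := (sa_symmetry L).
Local Notation K := (sa_closed L).
Local Notation D := (dualizing L).
Local Notation dd := (to_double_dual S K D).

Lemma lam_ext (X A B : L) (f g : Hom X (ihom K A B)) :
  ev K A B ∘ tmap M f (idm A) = ev K A B ∘ tmap M g (idm A) -> f = g.
Proof. by move=> e; rewrite -(lam_uniq f) e lam_uniq. Qed.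

Lemma tmap_split1 (A B A' B' : L) (f : Hom A A') (g : Hom B B') :
  tmap M f g = tmap M f (idm B') ∘ tmap M (idm A) g.
Proof. by rewrite -tmap_comp compose_idl compose_idr. Qed.

Lemma tmap_split2 (A B A' B' : L) (f : Hom A A') (g : Hom B B') :
  tmap M f g = tmap M (idm A') g ∘ tmap M f (idm B).
Proof. by rewrite -tmap_comp compose_idl compose_idr. Qed.

Lemma ev_dual_map (A B : L) (f : Hom A B) :
  ev K A D ∘ tmap M (dual_map f) (idm A) = ev K B D ∘ tmap M (idm (dual B)) f.
Proof. exact: ev_lam. Qed.

Lemma ev_double_dual (A : L) :
  ev K (dual A) D ∘ tmap M (dd A) (idm (dual A)) = ev K A D ∘ braid S A (dual A).
Proof. exact: ev_lam. Qed.

Lemma double_dual_nat (A B : L) (f : Hom A B) :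
  dual_map (dual_map f) ∘ dd A = dd B ∘ f.
Proof.
have tmap_compl X Y Z (g : Hom Y Z) (h : Hom X Y) W :
    tmap M (g ∘ h) (idm W) = tmap M g (idm W) ∘ tmap M h (idm W).
  by rewrite -tmap_comp compose_idl.
(* After evaluation and braiding, both sides apply a functional to [f a]. *)
apply: lam_ext.
rewrite !tmap_compl -!compose_assoc ev_dual_map ev_double_dual.
rewrite compose_assoc -tmap_split2 tmap_split1 -compose_assoc ev_double_dual.
rewrite !compose_assoc !braid_nat -!compose_assoc; congr (_ ∘ _).
exact: ev_dual_map.
Qed.

Lemma dual_map_is_iso (A B : L) (f : Hom A B) : is_iso f -> is_iso (dual_map f).
Proof.
move=> [g [gf fg]]; exists (dual_map g).
by rewrite -!dual_map_comp gf fg !dual_map_id.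
Qed.

(** The components of a natural transformation are data, whereas
    [to_double_dual_iso] only asserts that inverses exist; a left inverse given as
    data is the two-sided one. *)
Context (ddinv : forall A : L, Hom (dual (dual A)) A).
Hypothesis ddinvK : forall A : L, ddinv A ∘ dd A = idm A.

Lemma dd_ddinv (A : L) : dd A ∘ ddinv A = idm (dual (dual A)).
Proof.
have [g [_ dg]] := to_double_dual_iso A.
have -> : ddinv A = g.
  by rewrite -(compose_idr (ddinv A)) -dg -compose_assoc ddinvK compose_idl.
exact: dg.
Qed.

Lemma ddinv_nat (A B : L) (f : Hom A B) :
  f ∘ ddinv A = ddinv B ∘ dual_map (dual_map f).
Proof.
rewrite -[RHS]compose_idr -dd_ddinv !compose_assoc -(compose_assoc (dual_map _)).
by rewrite double_dual_nat -!compose_assoc ddinvK compose_idl.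
Qed.

Lemma ddinv_is_iso (A : L) : is_iso (ddinv A).
Proof. by exists (dd A); rewrite dd_ddinv ddinvK. Qed.

(** Up to double duals, [?(P ⊙ Q)] is the dual of [!(P^⊥ ⊠ Q^⊥)] and [?P ⊙ ?Q] the
    dual of [!(P^⊥) ⊠ !(Q^⊥)]. *)
Lemma whynot_par (T : Comonad L) :
  naturally_isomorphic (functor_comp (tensor_functor M) (prod_functor T T))
    (functor_comp T (tensor_functor M)) ->
  naturally_isomorphic
    (functor_comp (whynot_functor T) (par_functor L))
    (functor_comp (par_functor L)
       (prod_functor (whynot_functor T) (whynot_functor T))).
Proof.
move=> [t t_iso].
pose c (X : prod_cat L L) :
    Hom (tensor M (dual (dual (T (dual X.1)))) (dual (dual (T (dual X.2)))))
      (T (dual (dual (tensor M (dual X.1) (dual X.2))))) :=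
  fmap T (dd _) ∘ t (dual X.1, dual X.2) ∘ tmap M (ddinv _) (ddinv _).
unshelve refine (ex_intro _ (@Build_NatTrans _ _
  (functor_comp (whynot_functor T) (par_functor L))
  (functor_comp (par_functor L)
     (prod_functor (whynot_functor T) (whynot_functor T)))
  (fun X => dual_map (c X)) _) _); last first.
  move=> X; apply: dual_map_is_iso; rewrite /c.
  apply: comp_is_iso; last by apply: tmap_is_iso; exact: ddinv_is_iso.
  apply: comp_is_iso; last exact: t_iso.
  by apply: fmap_is_iso; exact: to_double_dual_iso.
move=> X Y f; rewrite /= -!dual_map_comp; congr dual_map.
have tn := @naturality _ _ _ _ t (dual Y.1, dual Y.2) (dual X.1, dual X.2)
  (dual_map f.1, dual_map f.2).
rewrite /= in tn.
rewrite /c !compose_assoc -tmap_comp -!ddinv_nat tmap_comp.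
rewrite -(compose_assoc (t _)) tn -!compose_assoc.
by rewrite -!fmap_comp double_dual_nat.
Qed.

End WhyNot.

(** * Affirmative pairs *)

Section Bang.
Context (H : BicartesianClosedCategory).

Local Notation "A × B" := (product (bcc_prod H) A B)
  (at level 40, left associativity).
Local Notation "A ⇒ B" := (exponential (bcc_exp H) A B)
  (at level 55, right associativity).
Local Notation "⟨ f , g ⟩" := (pairing (bcc_prod H) f g).
Local Notation π1 := (proj1 (bcc_prod H)).
Local Notation π2 := (proj2 (bcc_prod H)).
Local Notation λ := (curry (bcc_exp H)).
Local Notation O := (zero (bcc_coprod H)).
Local Notation M := (pm_monoidal H).

(** [refute] is the universal property of the pseudocomplement of [pos P], stated
    for maps out of a product rather than by an isomorphism
    [neg P ≅ (pos P ⇒ O)], because the negative part of [P ⊠ Q] is not an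
    exponential.  Together with [contra P] the two fields say that maps
    [X → neg P] and [pos P × X → O] correspond bijectively. *)
Record Affirmative (P : Hpm H) := {
  refute : forall X : H, Hom (pos P × X) O -> Hom X (neg P);
  refute_uniq : forall (X : H) (f g : Hom X (neg P)), f = g
}.

Lemma affirmative_ext (P Q : Hpm H) (a : Affirmative P) (f g : Hom P Q) :
  pos_map f = pos_map g -> f = g.
Proof. by move=> e; apply: pm_ext => //; exact: refute_uniq a _ _ _. Qed.

(** The negative component exists because [f] maps [pos P × neg Q] to
    [pos Q × neg Q], hence to [O]. *)
Definition lift (P Q : Hpm H) (a : Affirmative P) (f : Hom (pos P) (pos Q)) :
  Hom P Q :=
  pm_hom f (refute a (contra Q ∘ ⟨f ∘ π1, π2⟩)).

Lemma lift_is_iso (P Q : Hpm H) (a : Affirmative P) (b : Affirmative Q)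
  (f : Hom (pos P) (pos Q)) : is_iso f -> is_iso (lift a f).
Proof.
move=> [g [gf fg]]; exists (lift b g).
by split; [apply: (affirmative_ext a) | apply: (affirmative_ext b)].
Qed.

(** Functors with affirmative values are compared in [H], by their positive
    parts. *)
Lemma affirmative_natural_iso (C : Category) (F G : Functor C (Hpm H))
  (aF : forall A, Affirmative (F A)) (aG : forall A, Affirmative (G A))
  (t : forall A, Hom (pos (F A)) (pos (G A))) :
  (forall A, is_iso (t A)) ->
  (forall (A B : C) (f : Hom A B),
     t B ∘ pos_map (fmap F f) = pos_map (fmap G f) ∘ t A) ->
  naturally_isomorphic F G.
Proof.
move=> iso nat.
unshelve refine (ex_intro _
  (@Build_NatTrans _ _ F G (fun A => lift (aF A) (t A)) _) _).
  by move=> A B f; apply: (affirmative_ext (aF A)); exact: nat.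
by move=> A; exact: lift_is_iso.
Qed.

Lemma affirm_initial (A : H) : IsInitial (A × (A ⇒ O)).
Proof. exact: strict_zero (eval (bcc_exp H) ∘ ⟨π2, π1⟩). Qed.

Definition affirm (A : H) : Hpm H := Build_pm_ob (affirm_initial A).

Definition affirm_affirmative (A : H) : Affirmative (affirm A).
Proof.
split=> [X f|X f g] /=; first exact: (λ (f ∘ ⟨π2, π1⟩)).
by apply: curry_ext; exact: zero_uniq.
Defined.

Definition top_affirmative : Affirmative (munit M).
Proof.
split=> [X f|X f g] /=; last exact: zero_uniq.
exact: (f ∘ ⟨to_terminal (one_terminal (bcc_prod H)) X, idm X⟩).
Defined.

(** Refuting [P ⊠ Q] amounts to refuting [Q] given [P] and refuting [P] given [Q],
    which are the two components of the negative part of [P ⊠ Q]. *)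
Definition tensor_affirmative (P Q : Hpm H) (a : Affirmative P)
  (b : Affirmative Q) : Affirmative (tensor M P Q).
Proof.
split=> [X f|X f g] /=.
  apply: pairing; apply: curry.
    by apply: (refute b); exact: (f ∘ ⟨⟨π2 ∘ π2, π1⟩, π1 ∘ π2⟩).
  by apply: (refute a); exact: (f ∘ ⟨⟨π1, π2 ∘ π2⟩, π1 ∘ π2⟩).
apply: pairing_ext; apply: curry_ext; [exact: refute_uniq b _ _ _|].
exact: refute_uniq a _ _ _.
Defined.

(** * The comonad *)

Local Notation aff P := (affirm_affirmative (pos P)).

Definition bang_functor : Functor (Hpm H) (Hpm H).
Proof.
unshelve refine {| fobj (P : Hpm H) := affirm (pos P);
  fmap P Q f := @lift (affirm (pos P)) (affirm (pos Q)) (aff P) (pos_map f) |}.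
- abstract (by move=> P; exact: (affirmative_ext (aff P))).
- abstract (by move=> P Q R g f; exact: (affirmative_ext (aff P))).
Defined.

(** All structure maps have the identity as positive component, since
    [pos (!P)] is [pos P]: this makes the laws trivial and [bang] idempotent. *)
Definition bang : Comonad (Hpm H).
Proof.
unshelve refine {| com_functor := bang_functor;
  counit P := @lift (affirm (pos P)) P (aff P) (idm (pos P));
  comult P := @lift (affirm (pos P)) (affirm (pos P)) (aff P) (idm (pos P)) |};
  abstract (move=> *; apply: (affirmative_ext (affirm_affirmative _));
    rewrite /pos_map /= ?compose_idl ?compose_idr //).
Defined.

Lemma bang_idempotent : idempotent bang.
Proof. by move=> P; apply: lift_is_iso; [exact: (aff P) | exact: id_is_iso]. Qed.

(** * Positive components *)

Lemma pos_map_comp (P Q R : Hpm H) (g : Hom Q R) (f : Hom P Q) :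
  pos_map (g ∘ f) = pos_map g ∘ pos_map f.
Proof. by []. Qed.

Lemma pos_map_bang (P Q : Hpm H) (f : Hom P Q) :
  pos_map (fmap bang f) = pos_map f.
Proof. by []. Qed.

Lemma pos_map_counit (P : Hpm H) : pos_map (counit bang P) = idm (pos P).
Proof. by []. Qed.

Lemma pos_map_comult (P : Hpm H) : pos_map (comult bang P) = idm (pos P).
Proof. by []. Qed.

Lemma pos_map_id (P : Hpm H) : pos_map (idm P) = idm (pos P).
Proof. by []. Qed.

Lemma pos_tmap (P Q P' Q' : Hpm H) (f : Hom P P') (g : Hom Q Q') :
  pos_map (tmap M f g) = product_map (bcc_prod H) (pos_map f) (pos_map g).
Proof. by []. Qed.

Lemma pos_massoc (P Q R : Hpm H) :
  pos_map (massoc M P Q R) = ⟨π1 ∘ π1, ⟨π2 ∘ π1, π2⟩⟩.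
Proof. by []. Qed.

Lemma pos_mlunit (P : Hpm H) : pos_map (mlunit M P) = π2.
Proof. by []. Qed.

Lemma pos_mrunit (P : Hpm H) : pos_map (mrunit M P) = π1.
Proof. by []. Qed.

Lemma pos_braid (P Q : Hpm H) :
  pos_map (braid (pm_symmetry H) P Q) = ⟨π2, π1⟩.
Proof. by []. Qed.

(** * The Kleisli category is equivalent to the base *)

(* Keeps a Kleisli arrow [P → Q] distinct from the arrow [!P → Q] that it is. *)
Opaque Kleisli.

Definition kleisli_pos : Functor (Kleisli bang) H.
Proof.
refine {| fobj (P : Kleisli bang) := pos (of_kleisli_ob P) : H;
  fmap (P Q : Kleisli bang) (f : Hom P Q) := pos_map (of_kleisli f) :
    @Hom H (pos (of_kleisli_ob P)) (pos (of_kleisli_ob Q)) |}.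
- by [].
- move=> P Q R g f; rewrite of_kleisli_comp !pos_map_comp.
  by rewrite pos_map_bang pos_map_comult; exact: compose_idr.
Defined.

Definition kleisli_lift (P Q : Kleisli bang)
  (f : Hom (kleisli_pos P) (kleisli_pos Q)) : Hom P Q :=
  to_kleisli (T := bang) (A := P) (B := Q)
    (lift (Q := of_kleisli_ob Q)
      (affirm_affirmative (pos (of_kleisli_ob P))) f).

Lemma pos_kleisli (P Q : Kleisli bang) (f : Hom P Q) :
  fmap kleisli_pos f = pos_map (of_kleisli f).
Proof. by []. Qed.

Lemma pos_kleisli_lift (P Q : Kleisli bang)
  (f : Hom (kleisli_pos P) (kleisli_pos Q)) :
  fmap kleisli_pos (kleisli_lift f) = f.
Proof. by rewrite pos_kleisli to_kleisliK. Qed.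

Lemma pos_kleisli_id (P : Kleisli bang) :
  fmap kleisli_pos (idm P) = idm (kleisli_pos P).
Proof. exact: fmap_id. Qed.

Lemma pos_kleisli_comp (P Q R : Kleisli bang) (g : Hom Q R) (f : Hom P Q) :
  fmap kleisli_pos (g ∘ f) = fmap kleisli_pos g ∘ fmap kleisli_pos f.
Proof. exact: fmap_comp. Qed.

(** A Kleisli arrow starts at the affirmative object [!P], hence is determined by
    its positive component, which is arbitrary. *)
Definition kleisli_pos_ff : FullyFaithful kleisli_pos.
Proof.
apply: (@Build_FullyFaithful _ _ kleisli_pos kleisli_lift pos_kleisli_lift).
move=> P Q f g e; apply: of_kleisli_inj.
exact: affirmative_ext (affirm_affirmative (pos (of_kleisli_ob P))) _ _ e.
Defined.

Lemma kleisli_equivalent : equivalent (Kleisli bang) H.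
Proof.
apply: (@fully_faithful_equivalent _ _ _ kleisli_pos_ff
  (fun A : H => to_kleisli_ob bang (affirm A))
  (fun A => idm A) (fun A => idm A)); by move=> A /=; rewrite compose_idl.
Qed.

(** The product of [P] and [Q] in the Kleisli category is the product [P ⊓ Q] of
    pairs, whose positive part is the product of the positive parts. *)
Definition bang_products : FiniteProducts (Kleisli bang) :=
  reflect_products kleisli_pos_ff (o := to_kleisli_ob bang (pm_top H))
    (one_terminal (bcc_prod H))
    (p := fun P Q =>
      to_kleisli_ob bang (@pm_meet H (of_kleisli_ob P) (of_kleisli_ob Q)))
    (fun P Q =>
      product_is_product (bcc_prod H) (kleisli_pos P) (kleisli_pos Q)).

Definition bang_coproducts : FiniteCoproducts (Kleisli bang) :=
  reflect_coproducts kleisli_pos_ff (o := to_kleisli_ob bang (pm_bot H))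
    (zero_initial (bcc_coprod H))
    (p := fun P Q =>
      to_kleisli_ob bang (@pm_join H (of_kleisli_ob P) (of_kleisli_ob Q)))
    (fun P Q =>
      coproduct_is_coproduct (bcc_coprod H) (kleisli_pos P) (kleisli_pos Q)).

(** * The Seely condition *)

Local Notation N := (cartesian_monoidal bang_products).
Local Notation F := (kleisli_forget bang).

Lemma pos_pairing (X P Q : Kleisli bang) (f : Hom X P) (g : Hom X Q) :
  fmap kleisli_pos (pairing bang_products f g) =
  ⟨fmap kleisli_pos f, fmap kleisli_pos g⟩.
Proof. exact: fmap_preimage. Qed.

Lemma pos_proj1 (P Q : Kleisli bang) :
  fmap kleisli_pos (@proj1 _ bang_products P Q) = π1.
Proof. exact: fmap_preimage. Qed.

Lemma pos_proj2 (P Q : Kleisli bang) :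
  fmap kleisli_pos (@proj2 _ bang_products P Q) = π2.
Proof. exact: fmap_preimage. Qed.

Lemma pos_kleisli_tmap (P Q P' Q' : Kleisli bang) (f : Hom P P') (g : Hom Q Q') :
  fmap kleisli_pos (tmap N f g) =
  product_map (bcc_prod H) (fmap kleisli_pos f) (fmap kleisli_pos g).
Proof.
rewrite [tmap N f g]/(product_map _ _ _) /product_map pos_pairing.
by rewrite 2!pos_kleisli_comp pos_proj1 pos_proj2.
Qed.

Lemma pos_kleisli_massoc (P Q R : Kleisli bang) :
  fmap kleisli_pos (massoc N P Q R) = ⟨π1 ∘ π1, ⟨π2 ∘ π1, π2⟩⟩.
Proof.
rewrite [massoc N P Q R]/(pairing _ _ _) 2!pos_pairing 2!pos_kleisli_comp.
by rewrite 2!pos_proj1 2!pos_proj2.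
Qed.

Lemma pos_kleisli_mlunit (P : Kleisli bang) : fmap kleisli_pos (mlunit N P) = π2.
Proof. exact: pos_proj2. Qed.

Lemma pos_kleisli_mrunit (P : Kleisli bang) : fmap kleisli_pos (mrunit N P) = π1.
Proof. exact: pos_proj1. Qed.

Lemma pos_kleisli_braid (P Q : Kleisli bang) :
  fmap kleisli_pos (braid (cartesian_symmetry bang_products) P Q) = ⟨π2, π1⟩.
Proof.
by rewrite [braid _ P Q]/(pairing _ _ _) pos_pairing pos_proj1 pos_proj2.
Qed.

Lemma pos_forget (P Q : Kleisli bang) (f : Hom P Q) :
  pos_map (fmap F f) = fmap kleisli_pos f.
Proof.
rewrite kleisli_forget_map pos_map_comp pos_map_bang pos_map_comult.
exact: compose_idr.
Qed.

Lemma pos_cofree (P Q : Hpm H) (f : Hom P Q) :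
  fmap kleisli_pos (fmap (kleisli_cofree bang) f) = pos_map f.
Proof.
rewrite pos_kleisli of_kleisli_cofree pos_map_comp pos_map_counit.
exact: compose_idr.
Qed.

Local Notation aff2 P Q := (tensor_affirmative (aff P) (aff Q)).

Definition forget_affirmative (P : Kleisli bang) : Affirmative (F P) :=
  aff (of_kleisli_ob P).

Local Notation affF := forget_affirmative.

(** Both [!P ⊠ !Q] and [!(P ⊓ Q)] are affirmative with positive part
    [P⁺ × Q⁺]. *)
Definition forget_mu (P Q : Kleisli bang) :
  Hom (tensor M (F P) (F Q)) (F (tensor N P Q)) :=
  lift (P := tensor M (F P) (F Q)) (Q := F (tensor N P Q))
    (tensor_affirmative (affF P) (affF Q)) (idm _).

Definition forget_mu_unit : Hom (munit M) (F (munit N)) :=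
  lift (P := munit M) (Q := F (munit N)) top_affirmative (idm _).

Lemma pos_forget_mu (P Q : Kleisli bang) :
  pos_map (forget_mu P Q) = idm (kleisli_pos P × kleisli_pos Q).
Proof. by []. Qed.

Lemma pos_forget_mu_unit : pos_map forget_mu_unit = idm (one (bcc_prod H)).
Proof. by []. Qed.

Definition forget_strong : StrongMonoidal N M F.
Proof.
apply: (@Build_StrongMonoidal _ _ N M F forget_mu forget_mu_unit).
- move=> P Q P' Q' f g.
  apply: (affirmative_ext (tensor_affirmative (affF P) (affF Q))).
  rewrite 2!pos_map_comp 2!pos_forget_mu pos_tmap 3!pos_forget.
  by rewrite pos_kleisli_tmap compose_idl; exact: esym (compose_idr _).
- move=> P Q; apply: lift_is_iso; [exact: affF (tensor N P Q)|exact: id_is_iso].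
- apply: lift_is_iso; [exact: affF (munit N)|exact: id_is_iso].
- move=> P Q R.
  apply: (affirmative_ext
    (tensor_affirmative (tensor_affirmative (affF P) (affF Q)) (affF R))).
  rewrite 4!pos_map_comp pos_forget pos_kleisli_massoc 2!pos_tmap.
  rewrite 4!pos_forget_mu 2!pos_map_id pos_massoc 2!product_map_id.
  by rewrite !compose_idr !compose_idl.
- move=> P.
  apply: (affirmative_ext (tensor_affirmative top_affirmative (affF P))).
  rewrite 2!pos_map_comp pos_forget pos_kleisli_mlunit pos_forget_mu pos_tmap.
  rewrite pos_forget_mu_unit pos_map_id pos_mlunit product_map_id.
  by rewrite 2!compose_idr.
- move=> P.
  apply: (affirmative_ext (tensor_affirmative (affF P) top_affirmative)).
  rewrite 2!pos_map_comp pos_forget pos_kleisli_mrunit pos_forget_mu pos_tmap.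
  rewrite pos_forget_mu_unit pos_map_id pos_mrunit product_map_id.
  by rewrite 2!compose_idr.
Defined.

Definition forget_strong_symmetric :
  StrongSymmetricMonoidal (cartesian_symmetry bang_products)
    (pm_symmetry H) F.
Proof.
apply: (@Build_StrongSymmetricMonoidal _ _ _ _ _ _ _ forget_strong).
move=> P Q.
apply: (affirmative_ext (tensor_affirmative (affF P) (affF Q))).
rewrite 2!pos_map_comp pos_forget pos_kleisli_braid.
by rewrite 2!pos_forget_mu pos_braid compose_idl compose_idr.
Defined.

Definition bang_seely : SeelyComonad (Hpm_star H) :=
  @Build_SeelyComonad (Hpm_star H) bang bang_products forget_strong_symmetric.

(** * The right adjoint is strong monoidal *)

Local Notation U := (kleisli_cofree bang).

(** In the Kleisli category [P ⊓ Q] and [P ⊠ Q] are isomorphic, because their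
    positive parts are equal. *)
Definition cofree_mu (P Q : Hpm H) :
  Hom (tensor N (U P) (U Q)) (U (tensor M P Q)) :=
  kleisli_lift (P := tensor N (U P) (U Q)) (Q := U (tensor M P Q)) (idm _).

Definition cofree_mu_unit : Hom (munit N) (U (munit M)) :=
  kleisli_lift (P := munit N) (Q := U (munit M)) (idm _).

Lemma pos_cofree_mu (P Q : Hpm H) :
  fmap kleisli_pos (cofree_mu P Q) = idm (pos P × pos Q).
Proof. exact: pos_kleisli_lift. Qed.

Lemma pos_cofree_mu_unit :
  fmap kleisli_pos cofree_mu_unit = idm (one (bcc_prod H)).
Proof. exact: pos_kleisli_lift. Qed.

Definition cofree_strong : StrongMonoidal M N U.
Proof.
apply: (@Build_StrongMonoidal _ _ M N U cofree_mu cofree_mu_unit).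
- move=> P Q P' Q' f g; apply: (faithful kleisli_pos_ff).
  rewrite [LHS]pos_kleisli_comp [RHS]pos_kleisli_comp 2!pos_cofree_mu.
  rewrite pos_kleisli_tmap 3!pos_cofree pos_tmap compose_idl.
  exact: esym (compose_idr _).
- by move=> P Q; apply: (preimage_is_iso kleisli_pos_ff); exact: id_is_iso.
- by apply: (preimage_is_iso kleisli_pos_ff); exact: id_is_iso.
- move=> P Q R; apply: (faithful kleisli_pos_ff).
  rewrite [LHS]pos_kleisli_comp [RHS]pos_kleisli_comp.
  rewrite [X in X ∘ _ = _]pos_kleisli_comp [X in _ = X ∘ _]pos_kleisli_comp.
  rewrite pos_cofree pos_kleisli_massoc 2!pos_kleisli_tmap 4!pos_cofree_mu.
  rewrite 2!pos_kleisli_id pos_massoc 2!product_map_id.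
  by rewrite !compose_idr !compose_idl.
- move=> P; apply: (faithful kleisli_pos_ff).
  rewrite 2!pos_kleisli_comp pos_cofree pos_cofree_mu pos_kleisli_tmap.
  rewrite pos_cofree_mu_unit pos_kleisli_id pos_mlunit pos_kleisli_mlunit.
  by rewrite product_map_id 2!compose_idr.
- move=> P; apply: (faithful kleisli_pos_ff).
  rewrite 2!pos_kleisli_comp pos_cofree pos_cofree_mu pos_kleisli_tmap.
  rewrite pos_cofree_mu_unit pos_kleisli_id pos_mrunit pos_kleisli_mrunit.
  by rewrite product_map_id 2!compose_idr.
Defined.

Lemma pos_forget_counit (P : Hpm H) :
  pos_map (forget_counit bang P) = idm (pos P).
Proof. by []. Qed.

Lemma counit_cofree_forget (P Q : Hpm H) :
  of_kleisli (cofree_mu P Q) ∘ forget_mu (U P) (U Q) =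
  tmap M (forget_counit bang P) (forget_counit bang Q).
Proof.
apply: (affirmative_ext (tensor_affirmative (affF (U P)) (affF (U Q)))).
rewrite pos_map_comp -pos_kleisli pos_cofree_mu pos_forget_mu.
rewrite pos_tmap 2!pos_forget_counit product_map_id.
exact: compose_idl.
Qed.

Lemma counit_cofree_forget_unit :
  of_kleisli cofree_mu_unit ∘ forget_mu_unit = idm (munit M).
Proof.
apply: (affirmative_ext top_affirmative).
rewrite pos_map_comp -pos_kleisli pos_cofree_mu_unit pos_forget_mu_unit.
exact: compose_idl.
Qed.

Lemma cofree_strong_counit :
  monoidal_counit (kleisli_adjunction bang) forget_strong cofree_strong.
Proof.
apply: kleisli_monoidal_counit.
  exact: counit_cofree_forget.
exact: counit_cofree_forget_unit.
Qed.

(** * The isomorphisms for the exponentials *)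

Lemma bang_meet : naturally_isomorphic
  (functor_comp bang (product_functor (pm_products H)))
  (functor_comp (tensor_functor M) (prod_functor bang bang)).
Proof.
apply: (@affirmative_natural_iso _
  (functor_comp bang (product_functor (pm_products H)))
  (functor_comp (tensor_functor M) (prod_functor bang bang))
  (fun X => affirm_affirmative (pos X.1 × pos X.2))
  (fun X => aff2 X.1 X.2) (fun X => idm (pos X.1 × pos X.2))).
- by move=> X; exact: id_is_iso.
- by move=> X Y f; rewrite /= compose_idl compose_idr.
Qed.

Lemma bang_tensor : naturally_isomorphic
  (functor_comp bang (tensor_functor M))
  (functor_comp (tensor_functor M) (prod_functor bang bang)).
Proof.
apply: (@affirmative_natural_iso _
  (functor_comp bang (tensor_functor M))
  (functor_comp (tensor_functor M) (prod_functor bang bang))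
  (fun X => affirm_affirmative (pos X.1 × pos X.2))
  (fun X => aff2 X.1 X.2) (fun X => idm (pos X.1 × pos X.2))).
- by move=> X; exact: id_is_iso.
- by move=> X Y f; rewrite /= compose_idl compose_idr.
Qed.

Lemma tensor_bang : naturally_isomorphic
  (functor_comp (tensor_functor M) (prod_functor bang bang))
  (functor_comp bang (tensor_functor M)).
Proof.
apply: (@affirmative_natural_iso _
  (functor_comp (tensor_functor M) (prod_functor bang bang))
  (functor_comp bang (tensor_functor M))
  (fun X => aff2 X.1 X.2)
  (fun X => affirm_affirmative (pos X.1 × pos X.2))
  (fun X => idm (pos X.1 × pos X.2))).
- by move=> X; exact: id_is_iso.
- by move=> X Y f; rewrite /= compose_idl compose_idr.
Qed.

Lemma bang_top : isomorphic (bang (one (pm_products H))) (munit M).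
Proof.
exists (lift (P := bang (munit M)) (Q := munit M) (aff (munit M)) (idm _)).
by apply: lift_is_iso; [exact: top_affirmative | exact: id_is_iso].
Qed.

(** With [N = (P⁺ → 0) ∧ (1 → P⁻)], the positive part of [P^⊥], the double dual of
    [P] is [((N → 0) ∧ (1 → P⁺ ∧ 1), N ∧ 1)]; the map to [P⁺] evaluates the factor
    [1 → P⁺ ∧ 1], and the map [P⁻ → N] uses [P⁺ ∧ P⁻ → 0]. *)
Definition pm_dd_inv (P : Hpm_star H) : Hom (dual (dual P)) P :=
  pm_hom (P := pm_ihom (pm_ihom P (pm_bot H)) (pm_bot H)) (Q := P)
    (π1 ∘ (eval (bcc_exp H) ∘
      ⟨π2, to_terminal (one_terminal (bcc_prod H)) _⟩))
    ⟨⟨λ (contra P ∘ ⟨π2, π1⟩), λ π1⟩, to_terminal (one_terminal (bcc_prod H)) _⟩.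

Lemma pm_dd_invK (P : Hpm_star H) :
  pm_dd_inv P ∘
  to_double_dual (sa_symmetry (Hpm_star H)) (sa_closed (Hpm_star H))
    (dualizing (Hpm_star H)) P = idm P.
Proof.
apply: pm_ext; rewrite /pos_map /neg_map /=;
  repeat progress rewrite ?(compose_assoc, compose_idl, compose_idr,
    pairing_comp, proj1_pairing, proj2_pairing,
    eval_pairing_curry, eval_curry_comp); done.
Qed.

End Bang.

Transparent Kleisli.

Theorem lemma3p6 (H : BicartesianClosedCategory) :
  exists T : SeelyComonad (Hpm_star H),
    let M := sa_monoidal (Hpm_star H) in
    idempotent T /\
    (equivalent (Kleisli T) H /\ inhabited (FiniteCoproducts (Kleisli T))) /\
    (exists R : StrongMonoidal M (cartesian_monoidal (kleisli_products T))
                  (kleisli_cofree T),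
       monoidal_counit (kleisli_adjunction T) (seely_strong T) R) /\
    (naturally_isomorphic
       (functor_comp T (product_functor (pm_products H)))
       (functor_comp (tensor_functor M) (prod_functor T T)) /\
     isomorphic (T (one (pm_products H))) (munit M)) /\
    naturally_isomorphic
      (functor_comp T (tensor_functor M))
      (functor_comp (tensor_functor M) (prod_functor T T)) /\
    naturally_isomorphic
      (functor_comp (whynot_functor T) (par_functor (Hpm_star H)))
      (functor_comp (par_functor (Hpm_star H))
         (prod_functor (whynot_functor T) (whynot_functor T))).
Proof.
exists (bang_seely H); split; first exact: bang_idempotent.
split; first by split; [exact: kleisli_equivalent|split; exact: bang_coproducts].
split; first by exists (cofree_strong H); exact: cofree_strong_counit.
split; first by split; [exact: bang_meet | exact: bang_top].
split; first exact: bang_tensor.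
apply: (whynot_par (@pm_dd_invK H)); exact: tensor_bang.
Qed.
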